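(* Let $\Pi$ be a Pasch space (either spherical or regular) and let $A\in\Pi$. For $r_1,r_2\in\partial(\Pi,A)$ define $s[r_1,r_2]\subset\partial(\Pi,A)$ (the set of rays ''between $r_1$ and $r_2$'') as follows: (1) if $r_1$ and $r_2$ are antipodal or equal, then $s[r_1,r_2]=\{r_1,r_2\}$; (2) if $r_1$ and $r_2$ are different and not antipodal, then $r_3\in s[r_1,r_2]$ if and only if for every choice of $B\in r_1$ and $C\in r_2$ the ray $r_3$ intersects $s[B,C]$. Then this is a relation of betweenness on $\partial(\Pi,A)$.
   Context: A betweenness relation on a set $\Pi$ is a ternary relation ''$C$ is between $A$ and $B$'' such that, writing $s[A,B]$ for the set of all points between $A$ and $B$: (a) each point is between itself and any point of $\Pi$; (b) if $A$ is between $B$ and $C$, then $A$ is between $C$ and $B$; (c) if $C\in s[A,B]$, then $s[A,B]=s[A,C]\cup s[C,B]$ and $s[A,C]\cap s[C,B]=s[C,C]=\{C\}$. A closed line segment is a set of the form $s[A,B]$; its interior is $s(A,B)=s[A,B]\setminus\{A,B\}$. A subset $S$ is convex if $s[A,B]\subset S$ for all $A,B\in S$. A closed line segment is connected if, whenever it is expressed as a union of two disjoint non-empty convex subsets, precisely one of them is a closed line segment. A ray emanating from $A$ is a convex set $r$ such that: $A\in r$ but $A$ is not between any two other points of $r$; every three points of $r$ are contained in a closed line segment which is a subset of $r$; $r$ is not equal to any closed line segment. It is maximal if it is not a proper subset of another ray emanating from $A$, and connected if the closed line segments contained in it are connected. A space with maximal rays is a set with betweenness such that (1) if $s[A,B]$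 and $s[A,C]$ have a common interior point, then one of them is contained in the other; (2) if $A\neq B$ and $s[A,B]$ is connected, then there is a connected $s[C,D]$ with $s[A,B]\subset s(C,D)$. Two maximal rays $r_1,r_2$ emanating from the same point $A$ are antipodal if there are $B\in r_1$, $C\in r_2$ with $A\in s(B,C)$; each connected maximal ray $r$ has exactly one antipodal maximal ray, denoted $a(r)$. The boundary at infinity $\partial(\Pi,A)$ is the set of connected maximal rays emanating from $A$. A Pasch space is a space $\Pi$ with maximal rays satisfying the Pasch Condition: for every $A\in\Pi$ and every subset $\{r_1,r_2,r_3\}$ of $\partial(\Pi,A)$ disjoint from the set of its antipodal rays, and all points $B,C\in r_1\setminus\{A\}$ and $D\in r_3\setminus\{A\}$, if $r_2$ intersects $s[B,D]$ then $r_2$ intersects $s[C,D]$. A regular Pasch space is a Pasch space in which all closed line segments are connected. A spherical Pasch space is a Pasch space equipped with a map $a:\Pi\to\Pi$ (the antipodal map) with $a^2=\mathrm{id}$, $a(B)\neq B$ for all $B$, and $a(s[B,C])=s[a(B),a(C)]$ for all $B,C$, such that: for non-antipodal points $A,B$ (i.e. $B\ne a(A)$) $s[A,B]$ is connected; $s[A,B]$ consists of exactly two points if $a(B)=A$; and if $r_1,r_2$ are maximal rays emanating from the same point and $r_1\cup r_2$ contains a pair of antipodal points, then $r_1$ and $r_2$ are antipodal rays. *)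

(* Defs.v *)
From mathcomp Require Import all_boot.
From mathcomp Require Import boolp classical_sets.

Set Implicit Arguments.
Unset Strict Implicit.
Unset Printing Implicit Defensive.

Local Open Scope classical_set_scope.

(* A ternary relation on [T] is given as [s : T -> T -> set T]: [s A B C]
   reads "C is between A and B", so that [s A B] is the set s[A,B]. *)
Record betweenness (T : Type) (s : T -> T -> set T) : Prop := {
  between_end : forall A B, s A B A;
  between_sym : forall A B C, s B C A -> s C B A;
  between_split : forall A B C, s A B C ->
    [/\ s A B = s A C `|` s C B,
        s A C `&` s C B = s C C
      & s C C = [set C]]
}.

Section Spaces.
Variables (T : Type) (s : T -> T -> set T).
Implicit Types (A B C D : T) (X U V r : set T).

Definition closed_segment X := exists A B, X = s A B.

Definition open_segment A B : set T := s A B `\` [set A; B].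

Definition convex X := forall A B, X A -> X B -> s A B `<=` X.

Definition connected_segment X :=
  closed_segment X /\
  forall U V, X = U `|` V -> U `&` V = set0 -> U !=set0 -> V !=set0 ->
    convex U -> convex V ->
    (closed_segment U /\ ~ closed_segment V) \/
    (~ closed_segment U /\ closed_segment V).

Record ray A r : Prop := {
  ray_convex : convex r;
  ray_origin : r A;
  ray_extremal : forall B C, r B -> r C -> B <> A -> C <> A -> ~ s B C A;
  ray_directed : forall B C D, r B -> r C -> r D ->
    exists X, [/\ closed_segment X, X `<=` r, X B, X C & X D];
  ray_not_segment : ~ closed_segment r
}.

Definition maximal_ray A r :=
  ray A r /\ forall r', ray A r' -> ~ (r `<` r').

Definition connected_ray r :=
  forall X, closed_segment X -> X `<=` r -> connected_segment X.

Record space_with_maximal_rays : Prop := {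
  smr_betweenness : betweenness s;
  smr_comparable : forall A B C,
    open_segment A B `&` open_segment A C !=set0 ->
    s A B `<=` s A C \/ s A C `<=` s A B;
  smr_extend : forall A B, A <> B -> connected_segment (s A B) ->
    exists C D, connected_segment (s C D) /\ s A B `<=` open_segment C D
}.

(* Only meant for maximal rays [r1], [r2] emanating from [A]. *)
Definition antipodal A r1 r2 :=
  exists B C, [/\ r1 B, r2 C & open_segment B C A].

Definition boundary A : set (set T) :=
  [set r | maximal_ray A r /\ connected_ray r].

(* The set of the rays a(r), r in [R]. *)
Definition antipodal_rays A (R : set (set T)) : set (set T) :=
  [set r' | maximal_ray A r' /\ exists2 r, R r & antipodal A r r'].

Definition pasch_condition :=
  forall A r1 r2 r3,
    [set r1; r2; r3] `<=` boundary A ->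
    [set r1; r2; r3] `&` antipodal_rays A [set r1; r2; r3] = set0 ->
    forall B C D, (r1 `\ A) B -> (r1 `\ A) C -> (r3 `\ A) D ->
      r2 `&` s B D !=set0 -> r2 `&` s C D !=set0.

Definition pasch_space := space_with_maximal_rays /\ pasch_condition.

Definition regular_pasch_space :=
  pasch_space /\ forall X, closed_segment X -> connected_segment X.

Record spherical_pasch_space (a : T -> T) : Prop := {
  sph_pasch : pasch_space;
  sph_involutive : forall B, a (a B) = B;
  sph_fixfree : forall B, a B <> B;
  sph_image : forall B C, a @` s B C = s (a B) (a C);
  sph_connected : forall A B, B <> a A -> connected_segment (s A B);
  sph_two_points : forall A B, a B = A ->
    exists C D, C <> D /\ s A B = [set C; D];
  sph_antipodal : forall A r1 r2, maximal_ray A r1 -> maximal_ray A r2 ->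
    (exists B, (r1 `|` r2) B /\ (r1 `|` r2) (a B)) -> antipodal A r1 r2
}.

(* [boundary A], a set, is coerced to the subtype of its elements. *)
Definition between_rays A (r1 r2 : boundary A) : set (boundary A) :=
  [set r3 |
    (antipodal A (val r1) (val r2) \/ r1 = r2) /\ (r3 = r1 \/ r3 = r2)
    \/
    [/\ r1 <> r2, ~ antipodal A (val r1) (val r2)
      & forall B C, val r1 B -> val r2 C -> val r3 `&` s B C !=set0]].

End Spaces.

Arguments between_rays {T} s A r1 r2 _.

(* Main.v *)
Require Import Defs.
From mathcomp Require Import all_boot.
From mathcomp Require Import boolp classical_sets.

(* The only hard point is that two rays q1, q2 at A meeting all the segments that
   join two non-antipodal rays r1, r2 cannot be antipodal; then the Pasch condition
   applies to any three such rays and the betweenness axioms for rays are read off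
   from those of a single segment s[B,C], B in r1, C in r2.  So let X in q1 and Z
   in q2 lie on s[B,C], with q1 and q2 antipodal.

   In the spherical case q2 contains the antipode of X, and the rays from any Y in
   s[P,aX] to X and to P agree, both being antipodal to the ray to aX.  Hence A or
   its antipode lies on s[X,Z], so on s[B,C], unless Z is the antipode of X; each
   of these makes r1 and r2 antipodal.

   In the regular case A lies on s[X,Z].  Otherwise connectedness of segments gives
   Y in q1 and Z in q2 that are joined by a segment avoiding A, although A lies
   between all pairs of points of s[A,Y] and s[A,Z] other than Y, Z.  For D inside
   s[Y,Z] and a suitable W inside s[A,D], the Pasch condition at Z forces the ray
   from Z through W to meet s[A,Y], but all points of s[A,Y] except Y are on the
   ray from Z through A. *)

Set Implicit Arguments.
Unset Strict Implicit.
Unset Printing Implicit Defensive.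

Local Open Scope classical_set_scope.

(** * Order of the points on a segment *)

Section Betweenness.
Variables (T : Type) (s : T -> T -> set T).
Hypothesis sB : betweenness s.
Implicit Types A B C D P Q X Y Z : T.

Lemma betweenC A B C : s A B C -> s B A C.
Proof. exact: (between_sym sB). Qed.

Lemma betweenl A B : s A B A.
Proof. exact: between_end sB A B. Qed.

Lemma betweenr A B : s A B B.
Proof. exact/betweenC/betweenl. Qed.

Lemma segment1 A : s A A = [set A].
Proof. by have [_ _] := between_split sB (betweenl A A). Qed.

Lemma between_cat A B C D : s A B C -> s A B D -> s A C D \/ s C B D.
Proof. by move=> ABC; have [-> _ _] := between_split sB ABC. Qed.

Lemma between_meet A B C D : s A B C -> s A C D -> s C B D -> D = C.
Proof.
move=> ABC ACD CBD; have [_ I e] := between_split sB ABC.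
by have : s C C D; [rewrite -I | rewrite e].
Qed.

Lemma between_trans A B C D : s A B C -> s A C D -> s A B D.
Proof.
by move=> ABC ACD; have [-> _ _] := between_split sB ABC; left.
Qed.

Lemma between_anti A C D : s A C D -> s A D C -> C = D.
Proof.
by move=> ACD ADC; apply: (between_meet ACD ADC); apply: betweenr.
Qed.

(** The points come in the order [A], [D], [C], [B]: cutting at [D] leaves [C] in the second piece,
    unless [C] equals [D]. *)
Lemma between_shift A B C D : s A B C -> s A C D -> s D B C.
Proof.
move=> ABC ACD.
have [ADC|//] := between_cat (between_trans ABC ACD) ABC.
by rewrite (between_anti ACD ADC); apply: betweenl.
Qed.

Lemma between_linear A B C D : s A B C -> s A B D -> s A C D \/ s A D C.
Proof.
move=> ABC ABD; have [|CBD] := between_cat ABC ABD; first by left.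
by right; apply/betweenC/(between_shift (betweenC ABC)); apply: betweenC.
Qed.

Lemma between_mid A B C P Q : s A B C -> s A C P -> s C B Q -> s P Q C.
Proof.
move=> ABC ACP CBQ.
have PBC := between_shift ABC ACP.
exact: betweenC (between_shift (betweenC PBC) (betweenC CBQ)).
Qed.

Lemma convex_segment A B : convex s (s A B).
Proof.
move=> C D ABC ABD X CDX.
wlog ACD : C D ABC ABD CDX / s A C D.
  move=> W; have [ACD|ADC] := between_linear ABC ABD; first exact: (W C D).
  by apply: (W D C) => //; apply: betweenC.
apply: between_trans ABC _.
have [-> _ _] := between_split sB ACD.
by right; apply: betweenC.
Qed.

Lemma segment_extremal A C D : s A C D -> s C D A -> A = D.
Proof.
by move=> ACD CDA; apply: between_anti (betweenC ACD) CDA.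
Qed.

(** With nothing strictly between [P] and [Q], the segment would split into two disjoint convex
    pieces ending at [P] and starting at [Q]. Both are closed segments, whereas connectedness allows
    only one. *)
Lemma connected_dense B C P Q : connected_segment s (s B C) ->
  s B C P -> s B C Q -> P <> Q -> exists I, [/\ s P Q I, I <> P & I <> Q].
Proof.
wlog BQP : P Q / s B Q P.
  move=> W cBC BCP BCQ PQ.
  have [BPQ|BQP] := between_linear BCP BCQ; last exact: W.
  have [|I [QPI IQ IP]] := W Q P BPQ cBC BCQ BCP; first by move/esym.
  by exists I; split=> //; apply: betweenC.
move=> [_ cBC] BCP BCQ PQ; apply: contrapT => nI.
have cs A D : closed_segment s (s A D) by exists A, D.
have [] := cBC (s B P) (s Q C).
- apply/seteqP; split=> X; last first.
    case; first exact: between_trans BCP.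
    by move=> QCX; apply: (convex_segment BCQ _ QCX); apply: betweenr.
  move=> BCX; have [BQX|] := between_cat BCQ BCX; last by right.
  have [|PQX] := between_cat BQP BQX; first by left.
  have [->|XP] := EM (X = P); first by left; apply: betweenr.
  have [->|XQ] := EM (X = Q); first by right; apply: betweenl.
  by case: nI; exists X.
- apply/seteqP; split=> // X [BPX QCX].
  have BQX := between_trans BQP BPX.
  have XQ := between_meet BCQ BQX QCX; rewrite XQ in BPX.
  by apply: PQ; apply: between_anti BPX BQP.
- by exists B; apply: betweenl.
- by exists Q; apply: betweenl.
- exact: convex_segment.
- exact: convex_segment.
- by case=> _ [].
- by case=> -[].
Qed.

(** A segment inside [r] contains [A], [X] and [Y]. Extremality makes [A] one of its ends, and
    points of a segment are comparable as seen from an end. *)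
Lemma ray_comparable A r X Y : ray s A r -> r X -> r Y -> s A X Y \/ s A Y X.
Proof.
move=> rr rX rY.
have [_ [[P [Q ->]] Sr SA SX SY]] := ray_directed rr (ray_origin rr) rX rY.
wlog PA : P Q Sr SA SX SY / P = A; last first.
  by rewrite PA in SX SY; apply: between_linear SX SY.
move=> W; have [|PA] := EM (P = A); first exact: (W P Q).
have [QA|QA] := EM (Q = A).
  by apply: (W Q P) => //; first [exact: betweenC | move=> Z /betweenC/Sr].
case: (ray_extremal rr _ _ PA QA SA).
- exact/Sr/betweenl.
- exact/Sr/betweenr.
Qed.

End Betweenness.

(** For [A <> X] and connected [s A X] this turns out to be the unique maximal ray from [A] through
    [X]. For [A = X] the second disjunct always holds and the set is the whole space, hence the
    conditions [A <> X] below. *)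
Definition toward (T : Type) (s : T -> T -> set T) (A X : T) : set T :=
  [set Y | s A X Y \/ s A Y X].

(** * Comparability of points as seen from an origin *)

Section Rays.
Variables (T : Type) (s : T -> T -> set T).
Hypothesis sS : space_with_maximal_rays s.
Let sB : betweenness s := smr_betweenness sS.
Implicit Types (A B C D P Q X Y Z : T) (r : set T).

Lemma towardC A X Y : toward s A X Y -> toward s A Y X.
Proof. by case; [right | left]. Qed.

Lemma toward_origin A X : toward s A X A.
Proof. by left; apply: betweenl. Qed.

Lemma toward_target A X : toward s A X X.
Proof. by left; apply: betweenr. Qed.

Lemma toward_common A B C I :
  A <> I -> s A B I -> s A C I -> toward s A B C.
Proof.
move=> AI ABI ACI.
have [<-|BI] := EM (I = B); first by right.
have [<-|CI] := EM (I = C); first by left.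
have [|S|S] := smr_comparable sS (A := A) (B := B) (C := C).
- by exists I; split; split=> //= -[] // /esym.
- by right; apply: S (betweenr sB A B).
- by left; apply: S (betweenr sB A C).
Qed.

(** If [Y] precedes both other points, they share the interior point [Y]; if it follows both, they
    lie on one segment. The first case needs [A <> Y]. *)
Lemma toward_trans A X Y Z :
  A <> Y -> toward s A X Y -> toward s A Y Z -> toward s A X Z.
Proof.
move=> AY [AXY|AYX] [AYZ|AZY].
- by left; apply: between_trans AXY AYZ.
- exact: toward_common AY AXY AZY.
- by have [] := between_linear sB AYX AYZ; [left|right].
- by right; apply: between_trans AZY AYX.
Qed.

Lemma toward_eq A X Y :
  A <> X -> A <> Y -> toward s A X Y -> toward s A X = toward s A Y.
Proof.
move=> AX AY XY; apply/seteqP; split=> Z; apply: toward_trans => //.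
exact: towardC.
Qed.

Lemma extend_segment A B : A <> B -> connected_segment s (s A B) ->
  exists2 V, s A V B & V <> B.
Proof.
move=> AB cAB; have [C [D [_ S]]] := smr_extend sS AB cAB.
have [CDA _] := S _ (betweenl sB A B).
have [CDB nB] := S _ (betweenr sB A B).
have [CAB|CBA] := between_linear sB CDA CDB.
  exists C; first exact: betweenC.
  by move=> CB; apply: nB; left.
exists D; last by move=> DB; apply: nB; right.
exact: between_shift CDB CBA.
Qed.

End Rays.

(** * Boundary rays and antipodal rays *)

Section Boundary.
Variables (T : Type) (s : T -> T -> set T).
Hypothesis sS : space_with_maximal_rays s.
(** Lets segments be extended at every point of a ray. It is immediate in regular spaces and is
    [spherical_along] in spherical ones. *)
Hypothesis connected_along : forall A X Y, A <> X ->
  connected_segment s (s A X) -> toward s A X Y -> connected_segment s (s A Y).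
Let sB : betweenness s := smr_betweenness sS.
Implicit Types (A B C D P Q X Y Z : T) (r : set T).

Lemma toward_ray A X :
  A <> X -> connected_segment s (s A X) -> ray s A (toward s A X).
Proof.
move=> AX cAX.
have cmp P Q : toward s A X P -> toward s A X Q -> toward s A P Q.
  by move=> XP XQ; apply: toward_trans (towardC XP) XQ.
have sub P Q : toward s A X P -> s A P Q -> toward s A X Q.
  move=> XP APQ; have [AP|AP] := EM (A = P).
    by move: APQ; rewrite -AP segment1 // => ->; apply: toward_origin.
  by apply: toward_trans XP _ => //; left.
have ext P Q : toward s A X P -> toward s A X Q -> s P Q A -> A = P \/ A = Q.
  move=> XP XQ PQA; have [APQ|AQP] := cmp P Q XP XQ.
    by right; apply: segment_extremal APQ PQA.
  by left; apply: segment_extremal AQP (betweenC sB PQA).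
split.
- move=> P Q XP XQ; have [APQ|AQP] := cmp P Q XP XQ => Y PQY.
    apply: (sub P) => //.
    exact: (convex_segment sB (betweenr sB A P) APQ PQY).
  apply: (sub Q) => //.
  exact: (convex_segment sB AQP (betweenr sB A Q) PQY).
- exact: toward_origin.
- by move=> B C XB XC BA CA /ext []// /esym.
- move=> B C D XB XC XD.
  (* Of two points of the ray the farther one bounds both; used twice, this gives one segment from
     [A] containing [B], [C] and [D]. *)
  have top P Q : toward s A X P -> toward s A X Q ->
      exists M, [/\ toward s A X M, s A M P & s A M Q].
    move=> XP XQ; have [APQ|AQP] := cmp P Q XP XQ.
      by exists P; split=> //; apply: betweenr.
    by exists Q; split=> //; apply: betweenr.
  have [M [XM AMB AMC]] := top _ _ XB XC.
  have [N [XN ANM AND]] := top _ _ XM XD.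
  exists (s A N); split=> //.
  + by exists A, N.
  + by move=> Y; apply: sub.
  + exact: between_trans ANM AMB.
  + exact: between_trans ANM AMC.
- move=> [P [Q e]].
  have [XP XQ] : toward s A X P /\ toward s A X Q.
    by rewrite e; split; [apply: betweenl | apply: betweenr].
  (* If the ray were a segment, [A] would be one of its ends; an extension past the other end would
     still lie in the ray. *)
  wlog PA : P Q e XP XQ / A = P.
    move=> W; have [||AQ] := ext P Q XP XQ; last 1 first.
    - by apply: (W Q P); rewrite // e; apply/seteqP; split=> Y; apply: betweenC.
    - by rewrite -e; apply: toward_origin.
    - by move=> AP; apply: (W P Q).
  subst P.
  have AQ : A <> Q.
    move=> AQ; have := toward_target sS A X.
    by rewrite e -AQ segment1 // => /esym.
  have [V AVQ VQ] := extend_segment sS AQ (connected_along AX cAX XQ).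
  have : toward s A X V by apply: (toward_trans sS AQ XQ); right.
  by rewrite e => AQV; apply: VQ; apply: between_anti AVQ AQV.
Qed.

Lemma toward_maximal A X :
  A <> X -> connected_segment s (s A X) -> maximal_ray s A (toward s A X).
Proof.
move=> AX cAX; split=> [|r rr [S nS]]; first exact: toward_ray.
apply: nS => Y rY.
have rX := S _ (toward_target sS A X).
exact: (ray_comparable sB rr rX rY).
Qed.

Lemma maximal_ray_toward A X r : A <> X -> connected_segment s (s A X) ->
  maximal_ray s A r -> r X -> r = toward s A X.
Proof.
move=> AX cAX [rr mr] rX.
have S : r `<=` toward s A X.
  by move=> Y rY; exact: (ray_comparable sB rr rX rY).
apply/seteqP; split=> //; apply: contrapT => nS.
exact: mr (toward_ray AX cAX) (conj S nS).
Qed.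

Lemma boundary_connected A X r :
  boundary s A r -> r X -> connected_segment s (s A X).
Proof.
move=> [[rr _] cr] rX; apply: cr; first by exists A, X.
exact: ray_convex rr _ _ (ray_origin rr) rX.
Qed.

Lemma boundary_toward A X r :
  boundary s A r -> A <> X -> r X -> r = toward s A X.
Proof.
move=> br AX rX; apply: maximal_ray_toward => //; last by case: br.
exact: boundary_connected br rX.
Qed.

Lemma boundary_inj A X r1 r2 : boundary s A r1 -> boundary s A r2 ->
  A <> X -> r1 X -> r2 X -> r1 = r2.
Proof.
by move=> b1 b2 AX /(boundary_toward b1 AX)-> /(boundary_toward b2 AX)->.
Qed.

Lemma boundary_point A r : boundary s A r -> exists2 X, r X & A <> X.
Proof.
move=> [[rr _] _]; apply: contrapT => nX; apply: (ray_not_segment rr).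
exists A, A; rewrite segment1 //; apply/seteqP; split=> [Y rY|_ ->].
  by apply: contrapT => /= YA; apply: nX; exists Y => // /esym.
exact: ray_origin rr.
Qed.

Lemma antipodalC A r1 r2 : antipodal s A r1 r2 -> antipodal s A r2 r1.
Proof.
move=> [B [C [B1 C2 [BCA nA]]]]; exists C, B; split=> //; split.
  exact: betweenC.
by move=> [CA|BA]; apply: nA; [right|left].
Qed.

Lemma antipodal_intro A r1 r2 B C :
  r1 B -> r2 C -> A <> B -> A <> C -> s B C A -> antipodal s A r1 r2.
Proof. by move=> B1 C2 AB AC BCA; exists B, C; do 2!split=> //; case. Qed.

Lemma ray_not_antipodal A r : ray s A r -> ~ antipodal s A r r.
Proof.
move=> rr [B [C [rB rC [BCA nA]]]].
apply: (ray_extremal rr rB rC) BCA => E; apply: nA; first by left.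
by right.
Qed.

(** This makes the antipodal ray unique. The two pairs of witnesses may use different points [B1],
    [B2] on the ray of [P]. *)
Lemma antipodal_unique A P Q1 Q2 : A <> P ->
  antipodal s A (toward s A P) (toward s A Q1) ->
  antipodal s A (toward s A P) (toward s A Q2) -> toward s A Q1 Q2.
Proof.
move=> AP [B1 [C1 [PB1 QC1 [BCA1 nA1]]]] [B2 [C2 [PB2 QC2 [BCA2 nA2]]]].
have AC1 : A <> C1 by move=> E; apply: nA1; right.
have AC2 : A <> C2 by move=> E; apply: nA2; right.
apply: (toward_trans sS AC1) => //.
apply: (toward_trans sS AC2); last exact: towardC.
have : toward s A B1 B2 by apply: (toward_trans sS AP) => //; apply: towardC.
(* Seen from the nearer point [B1'], both [C1'] and [C2'] lie beyond [A], so they are comparable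
   there, and then also from [A]. *)
suff W B1' B2' C1' C2' : s A B2' B1' -> s B1' C1' A -> s B2' C2' A ->
    A <> B1' -> toward s A C1' C2'.
  case=> AB; last by apply: (W B1 B2) => // E; apply: nA1; left.
  by apply: towardC; apply: (W B2 B1) => // E; apply: nA2; left.
move=> AB BCA1' BCA2' AB1.
have BCA3 : s B1' C2' A := between_shift sB BCA2' (betweenC sB AB).
have [C1C2|C2C1] := toward_common sS (nesym AB1) BCA1' BCA3.
  by left; apply: (between_shift sB C1C2 BCA3).
by right; apply: (between_shift sB C2C1 BCA1').
Qed.

End Boundary.

(** No ray is antipodal to itself, so the disjointness in the Pasch condition amounts to three
    pairwise conditions. *)
Lemma pasch_rays (T : Type) (s : T -> T -> set T) A r1 r2 r3 B C D :
  pasch_space s -> boundary s A r1 -> boundary s A r2 -> boundary s A r3 ->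
  ~ antipodal s A r1 r2 -> ~ antipodal s A r1 r3 -> ~ antipodal s A r2 r3 ->
  r1 B -> A <> B -> r1 C -> A <> C -> r3 D -> A <> D ->
  r2 `&` s B D !=set0 -> r2 `&` s C D !=set0.
Proof.
move=> [sS sP] b1 b2 b3 n12 n13 n23 B1 AB C1 AC D3 AD.
have sB := smr_betweenness sS.
have n r : boundary s A r -> ~ antipodal s A r r.
  by case=> -[rr _] _; apply: ray_not_antipodal.
apply: (sP A r1 r2 r3); rewrite /setD /=.
- by move=> r [[]|] ->.
- apply/seteqP; split=> // r [/= rR [_ [r' r'R]]].
  case: rR => [[]|] ->; case: r'R => [[]|] -> //; try exact: n.
  + by move/(antipodalC sS).
  + by move/(antipodalC sS).
  + by move/(antipodalC sS).
- by split=> // /esym.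
- by split=> // /esym.
- by split=> // /esym.
Qed.

(** * Betweenness of rays, from two facts proved separately for the two kinds of space *)

Section Main.
Variables (T : Type) (s : T -> T -> set T).
Hypothesis sP : pasch_space s.
Hypothesis connected_along : forall A X Y, A <> X ->
  connected_segment s (s A X) -> toward s A X Y -> connected_segment s (s A Y).
Hypothesis antipodal_segment : forall A r1 r2 q1 q2 B C X Z,
  boundary s A r1 -> boundary s A r2 -> boundary s A q1 -> boundary s A q2 ->
  r1 B -> A <> B -> r2 C -> A <> C -> q1 X -> A <> X -> q2 Z -> A <> Z ->
  antipodal s A q1 q2 -> s B C X -> s B C Z -> antipodal s A r1 r2.
Let sS : space_with_maximal_rays s := sP.1.
Let sB : betweenness s := smr_betweenness sS.
Variable A : T.
Implicit Types (B C D P Q X Y Z : T) (r q : set T).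

Let inj := boundary_inj sS connected_along.

Let meets r1 r2 q := forall B C, r1 B -> r2 C -> q `&` s B C !=set0.

Let meetsC r1 r2 q : meets r1 r2 q -> meets r2 r1 q.
Proof.
move=> m B C B2 C1; have [X [qX CBX]] := m C B C1 B2.
by exists X; split=> //; apply: betweenC.
Qed.

Let meets_left r1 r2 : meets r1 r2 r1.
Proof. by move=> B C B1 _; exists B; split=> //; apply: betweenl. Qed.

Lemma meets_not_antipodal r1 r2 q1 q2 :
  boundary s A r1 -> boundary s A r2 -> boundary s A q1 -> boundary s A q2 ->
  ~ antipodal s A r1 r2 -> meets r1 r2 q1 -> meets r1 r2 q2 ->
  ~ antipodal s A q1 q2.
Proof.
move=> b1 b2 c1 c2 n12 m1 m2 a12; apply: (n12).
have [B B1 AB] := boundary_point sS b1.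
have [C C2 AC] := boundary_point sS b2.
have [X [qX BCX]] := m1 B C B1 C2.
have [Z [qZ BCZ]] := m2 B C B1 C2.
(* [A] on [s B C] would already make [r1] and [r2] antipodal. *)
have nA Y : s B C Y -> A <> Y.
  by move=> BCY AY; apply: n12; apply: (antipodal_intro B1 C2) => //; rewrite AY.
apply: (antipodal_segment b1 b2 c1 c2 B1 _ C2 _ qX _ qZ) => //; exact: nA.
Qed.

Lemma meets_trans r1 r2 r3 q :
  meets r1 r2 r3 -> meets r1 r3 q -> meets r1 r2 q.
Proof.
move=> m3 mq B C B1 C2; have [D [D3 BCD]] := m3 B C B1 C2.
have [E [qE BDE]] := mq B D B1 D3; exists E; split=> //.
exact: between_trans BCD BDE.
Qed.

(** One segment suffices: the Pasch condition moves [B] along [r1] and then, with the roles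
    exchanged, [D] along [r3]. *)
Lemma meets_extend r1 r3 q B D :
  boundary s A r1 -> boundary s A r3 -> boundary s A q ->
  ~ antipodal s A r1 q -> ~ antipodal s A r1 r3 -> ~ antipodal s A q r3 ->
  r1 B -> A <> B -> r3 D -> A <> D -> q `&` s B D !=set0 -> meets r1 r3 q.
Proof.
move=> b1 b3 bq n1q n13 nq3 B1 AB D3 AD qBD B' D' B1' D3'.
have qA : q A by case: (bq) => -[rq _] _; apply: ray_origin rq.
have [<-|AB'] := EM (A = B'); first by exists A; split=> //; apply: betweenl.
have [<-|AD'] := EM (A = D'); first by exists A; split=> //; apply: betweenr.
have := pasch_rays sP b1 bq b3 n1q n13 nq3 B1 AB B1' AB' D3 AD qBD.
have flip X Y : q `&` s X Y !=set0 -> q `&` s Y X !=set0.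
  by case=> Z [qZ XYZ]; exists Z; split=> //; apply: betweenC.
move/flip => qDB; apply: flip.
have nC r r' : ~ antipodal s A r r' -> ~ antipodal s A r' r.
  by move=> nrr /(antipodalC sS).
exact: (pasch_rays sP b3 bq b1 (nC _ _ nq3) (nC _ _ n13) (nC _ _ n1q)
  D3 AD D3' AD' B1' AB' qDB).
Qed.

(** On a single segment [s B C] the point of [q] falls on one side of the point of [r3];
    [meets_extend] passes from there to all segments. *)
Lemma meets_split r1 r2 r3 q :
  boundary s A r1 -> boundary s A r2 -> boundary s A r3 -> boundary s A q ->
  ~ antipodal s A r1 r2 -> meets r1 r2 r3 -> meets r1 r2 q ->
  meets r1 r3 q \/ meets r3 r2 q.
Proof.
move=> b1 b2 b3 bq n12 m3 mq.
have [B B1 AB] := boundary_point sS b1.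
have [C C2 AC] := boundary_point sS b2.
have [D [D3 BCD]] := m3 B C B1 C2.
have [E [qE BCE]] := mq B C B1 C2.
have AD : A <> D.
  by move=> AD; apply: n12; apply: (antipodal_intro B1 C2) => //; rewrite AD.
have n := meets_not_antipodal b1 b2 _ _ n12.
have m1 : meets r1 r2 r1 by exact: meets_left.
have m2 : meets r1 r2 r2 by apply/meetsC/meets_left.
have [BDE|DCE] := between_cat sB BCD BCE; [left|right].
  by apply: (meets_extend b1 b3 bq _ _ _ B1 AB D3 AD); [exact: n..|exists E].
by apply: (meets_extend b3 b2 bq _ _ _ D3 AD C2 AC); [exact: n..|exists E].
Qed.

(** [q] has points on both sides of the point [D] of [r3], so it contains [D] by convexity, and [D]
    determines the ray. *)
Lemma meets_both r1 r2 r3 q :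
  boundary s A r1 -> boundary s A r2 -> boundary s A r3 -> boundary s A q ->
  ~ antipodal s A r1 r2 -> meets r1 r2 r3 -> meets r1 r3 q -> meets r3 r2 q ->
  q = r3.
Proof.
move=> b1 b2 b3 bq n12 m3 m13 m32.
have [B B1 AB] := boundary_point sS b1.
have [C C2 AC] := boundary_point sS b2.
have [D [D3 BCD]] := m3 B C B1 C2.
have [E [qE BDE]] := m13 B D B1 D3.
have [F [qF DCF]] := m32 D C D3 C2.
have AD : A <> D.
  by move=> AD; apply: n12; apply: (antipodal_intro B1 C2) => //; rewrite AD.
apply: (inj bq b3 AD) => //.
case: (bq) => -[[cq _ _ _ _] _] _; apply: cq qE qF _ _.
exact: between_mid BCD BDE DCF.
Qed.

Lemma between_rays_betweenness : betweenness (between_rays s A).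
Proof.
have bd (R : boundary s A) : boundary s A (val R) by apply: set_valP.
have endl R1 R2 : between_rays s A R1 R2 R1.
  have [a12|n12] := EM (antipodal s A (val R1) (val R2) \/ R1 = R2).
    by left; split=> //; left.
  by right; split=> [e|a|]; [apply: n12; right|apply: n12; left|exact: meets_left].
have sym R1 R2 R3 : between_rays s A R1 R2 R3 -> between_rays s A R2 R1 R3.
  case=> [[h h']|[h h' m]]; [left; split|right; split].
  - by case: h => [/(antipodalC sS)|]; [left|right].
  - by case: h'; [right|left].
  - by move=> e; apply: h; rewrite e.
  - by move/(antipodalC sS).
  - exact: meetsC m.
have self R : between_rays s A R R = [set R].
  apply/seteqP; split=> [Q|_ ->]; last exact: endl.
  by case=> [[_ []]|[]].
split=> [||R1 R2 R3 h3]; [exact: endl|by move=> R1 R2 R3; exact: sym|].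
suff [h1 h2] : between_rays s A R1 R2 =
      between_rays s A R1 R3 `|` between_rays s A R3 R2 /\
    between_rays s A R1 R3 `&` between_rays s A R3 R2 = [set R3].
  by rewrite self.
(* When [R3] is an end, one of the two pieces is a singleton; this also disposes of equal or
   antipodal [R1], [R2]. *)
have [e|n31] := EM (R3 = R1).
  rewrite e self; split; apply/seteqP; split=> // Q.
  - by case=> // ->; apply: endl.
  - by move=> ->; split=> //; apply: endl.
have [e|n32] := EM (R3 = R2).
  rewrite e self; split; apply/seteqP; split=> // Q.
  - by case=> // ->; apply/sym/endl.
  - by move=> ->; split=> //; apply/sym/endl.
case: h3 => [[_ []]//|[n12 a12 m3]].
have m1 : meets (val R1) (val R2) (val R1) by exact: meets_left.
have m2 : meets (val R1) (val R2) (val R2) by apply/meetsC/meets_left.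
have n := meets_not_antipodal (bd R1) (bd R2) (bd _) (bd _) a12.
(* Since [R1] and [R3] are distinct and not antipodal, only the second clause of the definition can
   apply. *)
have E1 (Q : boundary s A) : between_rays s A R1 R3 Q <-> meets (val R1) (val R3) (val Q).
  split=> [[[[a|e] _]|[_ _]//]|m].
  - by case: (n R1 R3).
  - by case: n31.
  - by right; split=> //; [exact: nesym|exact: n].
have E2 (Q : boundary s A) : between_rays s A R3 R2 Q <-> meets (val R3) (val R2) (val Q).
  split=> [[[[a|e] _]|[_ _]//]|m].
  - by case: (n R3 R2).
  - by case: n32.
  - by right; split=> //; exact: n.
split; apply/seteqP; split=> Q.
- case=> [[[]]//|[_ _ mq]].
  have [m|m] := meets_split (bd R1) (bd R2) (bd R3) (bd Q) a12 m3 mq.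
    by left; apply/E1.
  by right; apply/E2.
- case=> [/E1|/E2] m; right; split=> //; first exact: meets_trans m3 m.
  by apply/meetsC/(meets_trans (meetsC m3))/meetsC.
- case=> /E1 m13 /E2 m32; apply: val_inj.
  exact: meets_both (bd _) (bd _) (bd _) (bd _) a12 m3 m13 m32.
- by move=> ->; split; [exact/sym/endl|exact: endl].
Qed.

End Main.

(** * Spherical spaces *)

Section Spherical.
Variables (T : Type) (s : T -> T -> set T) (a : T -> T).
Hypothesis sph : spherical_pasch_space s a.
Let sS : space_with_maximal_rays s := (sph_pasch sph).1.
Let sB : betweenness s := smr_betweenness sS.
Let aa := sph_involutive sph.
Implicit Types (A B C P Q X Y Z : T).

Lemma spherical_connected A B : A <> a B -> connected_segment s (s A B).
Proof. by move=> AB; apply: (sph_connected sph) => BA; rewrite BA aa in AB. Qed.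

Lemma antipodal_segment2 X Y : s X (a X) Y -> Y = X \/ Y = a X.
Proof.
have [C [D [_ e]]] := sph_two_points sph (aa X).
have eC Z : s X (a X) Z -> Z = C \/ Z = D by rewrite e.
have Xa := sph_fixfree sph (B := X).
have [e1|e1] := eC _ (betweenl sB _ _); have [e2|e2] := eC _ (betweenr sB _ _).
- by case: Xa; rewrite e2 -e1.
- by move=> /eC; rewrite e2 e1.
- by move=> /eC; rewrite e2 e1 => -[]; [right | left].
- by case: Xa; rewrite e2 -e1.
Qed.

(** Density would give a third point on the segment from [X] to [a X], which has only two. *)
Lemma connected_no_antipodes B C X :
  connected_segment s (s B C) -> s B C X -> ~ s B C (a X).
Proof.
move=> cBC BCX BCaX.
have [|I [XaI IX IaX]] := connected_dense sB cBC BCX BCaX.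
  by move/esym; apply: (sph_fixfree sph).
by have [] := antipodal_segment2 XaI.
Qed.

Lemma antipodes_segment B C X : s B C X -> s B C (a X) -> C = a B.
Proof.
move=> BCX BCaX; apply: contrapT => CB.
by apply: connected_no_antipodes BCX BCaX; apply: (sph_connected sph).
Qed.

(** Only [Y = a A] could fail, and then [s A X] would contain both [A] and [a A]. *)
Lemma spherical_along A X Y : A <> X -> connected_segment s (s A X) ->
  toward s A X Y -> connected_segment s (s A Y).
Proof.
move=> AX cAX XY; apply: spherical_connected => AY.
have e : a A = Y by rewrite AY aa.
rewrite -e in XY; case: XY => [AXaA|/antipodal_segment2[/nesym//|XA]].
  exact: (connected_no_antipodes cAX (betweenl sB A X)).
rewrite XA in cAX.
exact: (connected_no_antipodes cAX (betweenl sB _ _) (betweenr sB _ _)).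
Qed.

Lemma toward_antipodal A X : A <> X -> A <> a X ->
  antipodal s A (toward s A X) (toward s A (a X)).
Proof.
move=> AX AaX.
apply: (sph_antipodal sph).
- by apply: (toward_maximal sS spherical_along) => //; apply: spherical_connected.
- apply: (toward_maximal sS spherical_along) => //.
  by apply: spherical_connected; rewrite aa.
- by exists X; split; [left|right]; apply: toward_target.
Qed.

(* At Y the rays to X and to P are both antipodal to the ray to a X. *)
Lemma segment_antipode X P Y :
  X <> P -> s P (a X) Y -> Y <> a X -> s X Y P.
Proof.
move=> XP PaXY YaX; have [->|YP] := EM (Y = P); first exact: betweenr.
have cPaX : connected_segment s (s P (a X)).
  by apply: spherical_connected; rewrite aa; apply: nesym.
have nX : ~ s P (a X) X.
  by move=> PaXX; apply: connected_no_antipodes cPaX PaXX _; apply: betweenr.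
have YX : Y <> X by move=> YX; rewrite YX in PaXY.
have a1 : antipodal s Y (toward s Y (a X)) (toward s Y X).
  by apply: (antipodalC sS); apply: toward_antipodal.
have a2 : antipodal s Y (toward s Y (a X)) (toward s Y P).
  apply: (antipodal_intro (B := a X) (C := P)) => //; try exact: toward_target.
  exact: betweenC.
have [YXP|YPX] := antipodal_unique sS YaX a1 a2; first exact: betweenC.
case: nX; apply: between_trans PaXY _ => //.
exact: betweenC.
Qed.

Lemma spherical_antipodal_segment A r1 r2 q1 q2 B C X Z :
  boundary s A r1 -> boundary s A r2 -> boundary s A q1 -> boundary s A q2 ->
  r1 B -> A <> B -> r2 C -> A <> C -> q1 X -> A <> X -> q2 Z -> A <> Z ->
  antipodal s A q1 q2 -> s B C X -> s B C Z -> antipodal s A r1 r2.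
Proof.
move=> b1 b2 c1 c2 B1 AB C2 AC qX AX qZ AZ a12 BCX BCZ.
have naA r Y : boundary s A r -> r Y -> A <> a Y.
  move=> br rY AY; apply: (connected_no_antipodes (boundary_connected br rY)).
    exact: betweenr.
  by rewrite -AY; apply: betweenl.
have sub Y : s X Z Y -> s B C Y by apply: convex_segment.
have direct : C = a B -> antipodal s A r1 r2.
  move=> CB; apply: (sph_antipodal sph); [by case: b1|by case: b2|].
  by exists B; rewrite -CB; split; [left|right].
have aX : antipodal s A (toward s A X) (toward s A (a X)).
  by apply: toward_antipodal => //; apply: naA c1 qX.
rewrite (boundary_toward sS spherical_along c1 AX qX) in a12.
rewrite (boundary_toward sS spherical_along c2 AZ qZ) in a12.
have [ZaX|ZaX] := EM (Z = a X).
  by apply: direct; apply: antipodes_segment BCX _; rewrite -ZaX.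
(* The rays to [Z] and to [a X] are both antipodal to the ray to [X]. If [Z] precedes [a X], then
   [A] is on [s X Z]. *)
have [AZaX|AaXZ] := antipodal_unique sS AX a12 aX; last first.
  have XZA := segment_antipode (nesym AX) AaXZ ZaX.
  exact: antipodal_intro B1 C2 AB AC (sub _ XZA).
have XaZ : X <> a Z by move=> XaZ; apply: ZaX; rewrite XaZ aa.
(* Otherwise the antipodal map reverses the roles of [X] and [Z], and the same argument based at
   [a A] puts [a A] on [s X Z]. *)
have aAaZX : s (a A) (a Z) X by rewrite -(sph_image sph); exists (a X).
have ZaA : Z <> a A by move=> ZaA; apply: (naA q2 Z) => //; rewrite ZaA aa.
have BCaA := sub _ (betweenC sB (segment_antipode ZaA aAaZX XaZ)).
have aBaCA : s (a B) (a C) A by rewrite -(sph_image sph); exists (a A).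
have AaB := naA _ _ b1 B1; have AaC := naA _ _ b2 C2.
have aBC : antipodal s A (toward s A (a B)) (toward s A (a C)).
  by apply: antipodal_intro aBaCA => //; apply: toward_target.
(* The rays to [B] and to [a C] are both antipodal to the ray to [a B], so they agree; the ray to
   [C] is antipodal to the latter. *)
have BaC : toward s A B (a C).
  apply: (antipodal_unique sS AaB _ aBC).
  by apply: (antipodalC sS); apply: toward_antipodal.
rewrite (boundary_toward sS spherical_along b1 AB B1).
rewrite (boundary_toward sS spherical_along b2 AC C2).
rewrite (toward_eq sS AB AaC BaC).
by apply: (antipodalC sS); apply: toward_antipodal.
Qed.

End Spherical.

(** * Regular spaces: the origin lies between any two points of antipodal rays *)

Section Regular.
Variables (T : Type) (s : T -> T -> set T).
Hypothesis reg : regular_pasch_space s.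
Let sP : pasch_space s := reg.1.
Let sS : space_with_maximal_rays s := sP.1.
Let sB : betweenness s := smr_betweenness sS.
Implicit Types (A B C D I P Q V W X Y Z : T).

Lemma regular_connected A B : connected_segment s (s A B).
Proof. by apply: reg.2; exists A, B. Qed.

Let along A X Y : A <> X -> connected_segment s (s A X) ->
  toward s A X Y -> connected_segment s (s A Y) :=
  fun _ _ _ => regular_connected A Y.

Let extend A B : A <> B -> exists2 V, s A V B & V <> B.
Proof. by move=> AB; apply: extend_segment (regular_connected A B). Qed.

Let dense A B : A <> B -> exists I, [/\ s A B I, I <> A & I <> B].
Proof.
exact: (connected_dense sB (regular_connected A B) (betweenl sB A B)
  (betweenr sB A B)).
Qed.

Let down A P Y Z : s P Y A -> s A Y Z -> s P Z A.
Proof.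
move=> PYA AYZ; apply: (betweenC sB).
exact: (between_shift sB (betweenC sB PYA) (betweenC sB AYZ)).
Qed.

Lemma regular_boundary A X : A <> X -> boundary s A (toward s A X).
Proof.
move=> AX; split; last by move=> R [P [Q ->]] _; apply: regular_connected.
exact: (toward_maximal sS along AX (regular_connected A X)).
Qed.

(** Antipodality only provides some pair of witnesses; here [P] is kept. Extend the segment from [P]
    past [A], and take the nearer of the new end and [Q]. *)
Lemma antipodal_near A P Q : A <> P -> A <> Q ->
  antipodal s A (toward s A P) (toward s A Q) ->
  exists2 Q', A <> Q' & s A Q Q' /\ s P Q' A.
Proof.
move=> AP AQ aPQ; have [V PVA VA] := extend (nesym AP).
have aPV : antipodal s A (toward s A P) (toward s A V).
  by apply: antipodal_intro PVA => //; try exact: toward_target; apply: nesym.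
have [AQV|AVQ] := antipodal_unique sS AP aPQ aPV.
  by exists V => //; apply: nesym.
by exists Q => //; split; [apply: betweenr|apply: down PVA AVQ].
Qed.

(* The supremum of the points [Y] of [s A Q] with [A] in [s P Y]: since segments
   extend, it cannot be attained. *)
Lemma first_not_through A P Q Q' :
  A <> P -> ~ s P Q A -> s A Q Q' -> A <> Q' -> s P Q' A ->
  exists2 Y, s A Q Y /\ A <> Y &
    ~ s P Y A /\ forall X, s A Y X -> X <> Y -> s P X A.
Proof.
move=> AP nPQA AQQ' AQ' PQ'A.
pose U := [set Y | s A Q Y /\ s P Y A]; pose V := [set Y | s A Q Y /\ ~ s P Y A].
have UA : U A by split; [apply: betweenl|apply: betweenr].
(* For subsets of [s A Q], convexity reduces to the order of points as seen from [A]. *)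
have ord (R : set T) : (forall Y1 Y2 X, R Y1 -> R Y2 ->
    s A Y2 Y1 -> s A Y2 X -> s A X Y1 -> R X) -> R `<=` s A Q -> convex s R.
  move=> h RQ.
  suff c Y1 Y2 X : R Y1 -> R Y2 -> s A Y2 Y1 -> s Y1 Y2 X -> R X.
    move=> Y1 Y2 R1 R2 X YYX.
    have [AYY|AYY] := between_linear sB (RQ _ R1) (RQ _ R2); last exact: c YYX.
    exact: (c _ _ _ R2 R1 AYY (betweenC sB YYX)).
  move=> R1 R2 AYY YYX; have AY2X := convex_segment sB AYY (betweenr sB A Y2) YYX.
  apply: (h Y1 Y2) => //.
  exact: (betweenC sB (between_shift sB (betweenC sB AYY) (betweenC sB YYX))).
have cU : convex s U.
  apply: ord => [Y1 Y2 X [_ _] [AQ2 P2A] _ A2X _|Y []//].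
  by split; [apply: between_trans AQ2 A2X|apply: down P2A A2X].
have cV : convex s V.
  apply: ord => [Y1 Y2 X [_ nP1A] [AQ2 _] _ A2X AX1|Y []//].
  by split; [apply: between_trans AQ2 A2X|move=> PXA; apply/nP1A/(down PXA)].
have [] := (regular_connected A Q).2 U V => //.
- apply/seteqP; split=> Y; last by case=> -[].
  by move=> AQY; have [] := EM (s P Y A); [left|right].
- by apply/seteqP; split=> // Y [[_ ?] [_ ?]].
- by exists A.
- by exists Q; split=> //; apply: betweenr.
(* If [U] is a segment, it is [s A F]. Extending [s P F] past [F] gives a point [G] that either
   still belongs to [U] or lies beyond [Q]; both are impossible. *)
- case=> -[E [F UE]] _.
  wlog EA : E F UE / E = A.
    move=> W; move: (UA); rewrite UE => EFA.
    have UEE : U E by rewrite UE; apply: betweenl.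
    have UFF : U F by rewrite UE; apply: betweenr.
    have [AEF|AFE] := between_linear sB UEE.1 UFF.1.
      apply: (W F E); first by rewrite UE; apply/seteqP; split=> ?; apply: betweenC.
      by apply: esym; apply: (segment_extremal sB AEF).
    apply: (W E F) => //; apply: esym.
    by apply: (segment_extremal sB AFE); apply: betweenC.
  have [AQF PFA] : U F by rewrite UE; apply: betweenr.
  have AF : A <> F.
    move=> AF; have : U Q' by [].
    by rewrite UE EA -AF segment1 // => /esym.
  have PF : P <> F by move=> PF; move: PFA; rewrite -PF segment1.
  have [G PGF GF] := extend PF.
  have AGF := between_shift sB PGF PFA.
  have PGA := between_trans sB PGF PFA.
  have [AQG|AGQ] := toward_common sS AF AQF AGF.
    have : U G by [].
    by rewrite UE EA => AFG; case: GF; apply: between_anti AGF _.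
  by case: nPQA; apply: down PGA AGQ.
(* If [V] is a segment, its end nearer to [A] is the required point. *)
- case=> _ [E [F VE]].
  wlog AFE : E F VE / s A F E.
    have VEE : V E by rewrite VE; apply: betweenl.
    have VFF : V F by rewrite VE; apply: betweenr.
    move=> W; have [AEF|] := between_linear sB VEE.1 VFF.1; last exact: W.
    by apply: (W F E) => //; rewrite VE; apply/seteqP; split=> ?; apply: betweenC.
  have [AQE nPEA] : V E by rewrite VE; apply: betweenl.
  exists E; split=> //; first by move=> AE; apply: nPEA; rewrite -AE; apply: betweenr.
  move=> X AEX XE; apply: contrapT => nPXA.
  have : V X by split=> //; apply: between_trans AQE AEX.
  by rewrite VE => /(between_meet sB AFE AEX).
Qed.

(* The straight angle at [A] between [Y] and [Z] stops being a segment exactly at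
   the pair [Y], [Z], which is then joined by a segment avoiding [A]. *)
Definition bigon A Y Z :=
  [/\ A <> Y, A <> Z, ~ s Y Z A,
      forall P, s A Y P -> P <> Y -> s P Z A
    & forall P, s A Z P -> P <> Z -> s P Y A].

Lemma bigonC A Y Z : bigon A Y Z -> bigon A Z Y.
Proof. by case=> AY AZ nYZA mY mZ; split=> // /(betweenC sB). Qed.

(** Otherwise [A] and [Y] would both lie on [s P Z], so one would lie between [P] and the other,
    although [P] lies between them. *)
Lemma bigon_no_extension A Y Z P :
  bigon A Y Z -> s A Y P -> P <> Y -> ~ s Z P Y.
Proof.
move=> [AY AZ nYZA mY mZ] AYP PY ZPY.
(* For [P = A] this is no contradiction; an interior point [I] of [s A Y] is used instead. *)
have [AP|AP] := EM (A = P).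
  have [I [AYI IA IY]] := dense AY.
  rewrite -AP in ZPY.
  apply: IA; apply: (between_anti sB (betweenC sB (mY I AYI IY))).
  exact: (betweenC sB (between_trans sB (betweenC sB ZPY) AYI)).
have PZA := mY P AYP PY.
have [PAY|PYA] := between_linear sB PZA (betweenC sB ZPY).
  by apply: PY; apply: (between_anti sB (betweenC sB PAY)).
by apply: AP; apply: (between_anti sB (betweenC sB AYP) (betweenC sB PYA)).
Qed.

Lemma bigon_neq A Y Z : bigon A Y Z -> Y <> Z.
Proof.
move=> b YZ; have [AY _ _ _ _] := b.
apply: (bigon_no_extension b (betweenl sB A Y) AY).
rewrite -YZ; exact: (betweenl sB Y A).
Qed.

(** Extend [s Z Y] past [Y] to [V]. Seen from [Q], both [V] and [P] lie beyond [Y], so the nearer of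
    them continues [s Z Y] inside [s A Y] or is [P] itself. *)
Lemma bigon_corner A Y Z P Q : bigon A Y Z ->
  s A Y P -> s Y Z Q -> P <> Y -> Q <> Y -> ~ s P Q Y.
Proof.
move=> b AYP YZQ PY QY PQY; have YZ := bigon_neq b.
have [V ZVY VY] := extend (nesym YZ).
have QVY := between_shift sB ZVY (betweenC sB YZQ).
have [QVP|QPV] := toward_common sS QY QVY (betweenC sB PQY).
  apply: (bigon_no_extension b AYP PY).
  have YVP := between_shift sB QVP (betweenC sB PQY).
  exact: (betweenC sB (between_shift sB (betweenC sB ZVY) (betweenC sB YVP))).
have YPV := between_shift sB QPV QVY.
apply: (bigon_no_extension b _ VY ZVY).
exact: (convex_segment sB (betweenr sB A Y) AYP YPV).
Qed.

Lemma bigon_side A Y Z D : bigon A Y Z -> s Y Z D -> D <> Y -> ~ toward s A Y D.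
Proof.
move=> b YZD DY [AYD|ADY].
  case: b => _ _ nYZA mY _; apply: nYZA.
  exact: (convex_segment sB YZD (betweenr sB Y Z) (mY D AYD DY)).
have [AY _ _ _ _] := b.
exact: (bigon_corner b (betweenl sB A Y) YZD AY DY ADY).
Qed.

(** * A segment from [A] to the opposite side of a bigon, seen from [Z] *)

Section Transversal.
Variables A Y Z D : T.
Hypothesis b : bigon A Y Z.
Hypotheses (YZD : s Y Z D) (DY : D <> Y) (DZ : D <> Z).

Let nY : ~ toward s A Y D. Proof. exact: bigon_side b YZD DY. Qed.
Let nZ : ~ toward s A Z D.
Proof. exact: bigon_side (bigonC b) (betweenC sB YZD) DZ. Qed.
Let nA : ~ s Y Z A. Proof. by case: b. Qed.

(** Before [A], a common point would identify the directions from [A] to [Z] and to [D]. Past [A],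
    the ray from [Z] runs along [s A Y], which would identify those to [Y] and to [D]. *)
Lemma transversal_side W : s A D W -> W <> A -> ~ toward s Z A W.
Proof.
move=> ADW WA [ZAW|ZWA].
  by apply: nZ; apply: (toward_common sS (nesym WA) (betweenC sB ZAW) ADW).
have [AY _ _ mY _] := b.
have [I [AYI IA IY]] := dense AY.
have ZIA := betweenC sB (mY I AYI IY).
have ZA : Z <> A by case: b => _ /nesym.
apply: nY; have [ZWI|ZIW] := toward_common sS ZA ZWA ZIA.
  have AWI := between_shift sB ZWI ZIA.
  exact: (toward_common sS (nesym IA) AYI (between_trans sB ADW AWI)).
have AIW := between_shift sB ZIW ZWA.
exact: (toward_common sS (nesym WA) (between_trans sB AYI AIW) ADW).
Qed.

Lemma transversal_base W : s A D W -> W <> D -> ~ toward s Z D W.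
Proof.
move=> ADW WD.
have DAW := betweenC sB ADW.
have key X : s Y Z X -> s D X W -> ~ toward s A X D -> False.
  move=> YZX DXW nX.
  have [DAX|DXA] := toward_common sS (nesym WD) DAW DXW.
    by apply: nX; right; apply: betweenC.
  by apply: nA; apply: (convex_segment sB YZD YZX DXA).
case=> [ZDW|ZWD].
  exact: (key Z (betweenr sB Y Z) (betweenC sB ZDW) nZ).
have [ZWY|ZYW] := toward_common sS (nesym DZ) ZWD (betweenC sB YZD).
  have DWY := between_shift sB ZWY (betweenC sB YZD).
  by apply: nY; right; apply/(betweenC sB)/(between_trans sB DAW).
exact: (key Y (betweenl sB Y Z) (between_shift sB ZYW ZWD) nY).
Qed.

(** From the farther of the two as seen from [Z], the direction to [Z] would be that along [s A D],
    so [Z] would be comparable there with [A] or with [D]. *)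
Lemma transversal_injective W1 W2 : s A D W1 -> s A D W2 ->
  W1 <> A -> W2 <> A -> W1 <> D -> W2 <> D -> W1 <> W2 -> ~ toward s Z W1 W2.
Proof.
wlog AWW : W1 W2 / s A W2 W1.
  move=> h D1 D2 A1 A2 n1 n2 n12.
  have [AWW|AWW] := between_linear sB D1 D2; last exact: h.
  by move/(towardC (s := s)); apply: h => //; apply: nesym.
move=> D1 D2 A1 A2 n1 n2 n12.
have nADZ : ~ s A D Z by move=> ADZ; apply: nZ; right.
case=> [ZWW|ZWW].
  have WDW := between_shift sB D2 AWW.
  have [WZD|WDZ] := toward_common sS n12 (betweenC sB ZWW) WDW.
    by apply: (transversal_base D1 n1); right; apply: betweenC.
  by apply: nADZ; apply: (convex_segment sB D1 (betweenr sB A D) WDZ).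
have [WZA|WAZ] := toward_common sS (nesym n12) (betweenC sB ZWW) (betweenC sB AWW).
  by apply: (transversal_side D2 A2); right; apply: betweenC.
by apply: nADZ; apply: (between_trans sB D2); apply: betweenC.
Qed.

Lemma transversal_pasch W : s A D W -> W <> A -> W <> D ->
  ~ antipodal s Z (toward s Z A) (toward s Z W) ->
  ~ antipodal s Z (toward s Z D) (toward s Z W) -> False.
Proof.
move=> ADW WA WD nAW nDW.
have [AY AZ _ mY _] := b.
have ZY := nesym (bigon_neq b).
have ZD := nesym DZ.
have ZDY : toward s Z D Y by right; apply: betweenC.
have nSide : ~ toward s Z A W := transversal_side ADW WA.
have nBase : ~ toward s Z D W := transversal_base ADW WD.
have ZW : Z <> W by move=> ZW; apply: nBase; rewrite -ZW; apply: toward_origin.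
(* Antipodality here would yield a segment through the corner [Z], against [bigon_corner]. *)
have nDA : ~ antipodal s Z (toward s Z D) (toward s Z A).
  move=> aDA; have [P ZP [ZAP DPZ]] := antipodal_near ZD (nesym AZ) aDA.
  apply: (bigon_corner (bigonC b) (betweenC sB ZAP) (betweenC sB YZD)) => //.
    exact: nesym.
  exact: betweenC.
have nWA : ~ antipodal s Z (toward s Z W) (toward s Z A).
  by move/(antipodalC sS).
(* The ray to [W] crosses [s D A] at [W]; [D] is then moved to [Y] on the same ray. *)
have [|V [ZWV YAV]] := pasch_rays sP (regular_boundary ZD) (regular_boundary ZW)
  (regular_boundary (nesym AZ)) nDW nDA nWA (toward_target sS Z D) ZD ZDY ZY
  (toward_target sS Z A) (nesym AZ).
  by exists W; split; [apply: toward_target|apply: betweenC].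
have [VY|VY] := EM (V = Y).
  apply: nBase; rewrite VY in ZWV.
  by apply: (toward_trans sS ZY ZDY); apply: towardC.
have ZVA := betweenC sB (mY V (betweenC sB YAV) VY).
have ZV : Z <> V.
  by move=> ZV; apply: AZ; move: ZVA; rewrite -ZV segment1.
by apply: nSide; apply: towardC; apply: (toward_trans sS ZV ZWV); left.
Qed.

End Transversal.

(* Of three distinct points [W] inside [s A D], two would span with [Z] the ray
   antipodal to the same side at [Z], hence the same ray. *)
Lemma bigon_absurd A Y Z : ~ bigon A Y Z.
Proof.
move=> b; have [AY AZ _ _ _] := b.
have [D [YZD DY DZ]] := dense (bigon_neq b).
have ZA := nesym AZ; have ZD := nesym DZ.
have AD : A <> D.
  by move=> AD; case: b => _ _ nYZA _ _; apply: nYZA; rewrite AD.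
have [W2 [ADW2 W2A W2D]] := dense AD.
have [W1 [AWW1 W1A W12]] := dense (nesym W2A).
have [W3 [WDW3 W32 W3D]] := dense W2D.
have ADW1 := between_trans sB ADW2 AWW1.
have ADW3 : s A D W3 := convex_segment sB ADW2 (betweenr sB A D) WDW3.
have AW3W2 := betweenC sB (between_shift sB (betweenC sB ADW2) (betweenC sB WDW3)).
have W3A : W3 <> A.
  by move=> W3A; apply: W2A; move: AW3W2; rewrite W3A segment1.
have W13 : W1 <> W3.
  by move=> W13; apply: W12; apply: (between_anti sB _ AWW1); rewrite W13.
have inj := transversal_injective b YZD DY DZ.
have bad W : s A D W -> W <> A -> W <> D ->
    antipodal s Z (toward s Z A) (toward s Z W) \/
    antipodal s Z (toward s Z D) (toward s Z W).
  move=> ADW WA WD; apply: contrapT => /not_orP[nA nD].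
  exact: (transversal_pasch b YZD DY DZ ADW WA WD nA nD).
have W1D : W1 <> D.
  by move=> W1D; apply: W2D; rewrite W1D in AWW1; apply: (between_anti sB AWW1 ADW2).
have i12 := inj _ _ ADW1 ADW2 W1A W2A W1D W2D W12.
have i13 := inj _ _ ADW1 ADW3 W1A W3A W1D W3D W13.
have i23 := inj _ _ ADW2 ADW3 W2A W3A W2D W3D (nesym W32).
have sameA := antipodal_unique sS ZA; have sameD := antipodal_unique sS ZD.
have [a1|a1] := bad _ ADW1 W1A W1D; have [a2|a2] := bad _ ADW2 W2A W2D;
  have [a3|a3] := bad _ ADW3 W3A W3D;
  first [exact: (i12 (sameA _ _ a1 a2)) | exact: (i12 (sameD _ _ a1 a2))
    | exact: (i13 (sameA _ _ a1 a3)) | exact: (i13 (sameD _ _ a1 a3))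
    | exact: (i23 (sameA _ _ a2 a3)) | exact: (i23 (sameD _ _ a2 a3))].
Qed.

(** If it failed, [first_not_through] would shorten [P] to [Y] and then, relative to [Y], shorten
    [Q] to [Z], producing a bigon. *)
Lemma antipodal_between A P Q : A <> P -> A <> Q ->
  antipodal s A (toward s A P) (toward s A Q) -> s P Q A.
Proof.
move=> AP AQ aPQ; apply: contrapT => nPQA.
have aQP := antipodalC sS aPQ.
have [P' AP' [APP' QP'A]] := antipodal_near AQ AP aQP.
have nQPA : ~ s Q P A by move/(betweenC sB).
have [Y [APY AY] [nQYA mY]] := first_not_through AQ nQPA APP' AP' QP'A.
have PY : toward s A P Y by left.
rewrite (toward_eq sS AP AY PY) in aPQ.
have [Q' AQ' [AQQ' YQ'A]] := antipodal_near AY AQ aPQ.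
have nYQA : ~ s Y Q A by move/(betweenC sB).
have [Z [AQZ AZ] [nYZA mZ]] := first_not_through AY nYQA AQQ' AQ' YQ'A.
apply: (@bigon_absurd A Y Z); split=> // X AX XX; last exact/(betweenC sB)/mZ.
(* [Y] was chosen relative to [Q]; its property passes to [Z], which lies on [s A Q]. *)
by apply: down AQZ; apply/(betweenC sB)/mY.
Qed.

Lemma regular_antipodal_segment A r1 r2 q1 q2 B C X Z :
  boundary s A r1 -> boundary s A r2 -> boundary s A q1 -> boundary s A q2 ->
  r1 B -> A <> B -> r2 C -> A <> C -> q1 X -> A <> X -> q2 Z -> A <> Z ->
  antipodal s A q1 q2 -> s B C X -> s B C Z -> antipodal s A r1 r2.
Proof.
move=> _ _ c1 c2 B1 AB C2 AC qX AX qZ AZ a12 BCX BCZ.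
rewrite (boundary_toward sS along c1 AX qX) in a12.
rewrite (boundary_toward sS along c2 AZ qZ) in a12.
apply: antipodal_intro B1 C2 AB AC _.
exact: (convex_segment sB BCX BCZ (antipodal_between AX AZ a12)).
Qed.

End Regular.

Theorem proposition5p6 (Pi : Type) (s : Pi -> Pi -> set Pi)
    (HPi : regular_pasch_space s \/ exists a : Pi -> Pi, spherical_pasch_space s a)
    (A : Pi) :
  betweenness (between_rays s A).
Proof.
case: HPi => [reg|[a sph]].
  apply: (between_rays_betweenness reg.1); last exact: regular_antipodal_segment.
  by move=> *; apply: regular_connected.
apply: (between_rays_betweenness (sph_pasch sph)).
  exact: spherical_along sph.
exact: spherical_antipodal_segment sph.
Qed.
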